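(* Suppose that the set of possible values of the observations is finite. Let $\eta$ be a function on $\Theta$, and suppose that there exist a function $h$ and a set $A$ in the sample space such that (i) $\eta(\theta)=E_\theta\big(h(Y)\mid Y\in A\big)$ for every $\theta\in\Theta$; (ii) $\inf_{\theta\in\Theta}P_\theta(Y\in A)>0$. For each $n$ let $\hat G^{1}=\hat G^{1,n}$ and $\hat G^{2}=\hat G^{2,n}$ be GMLEs based on $Y_1,\dots,Y_n$ (both computed with the same one of the likelihood versions described in the context). Then, for any two such sequences of GMLEs, with probability one, $$\lim_{n\to\infty}\big[E_{\hat G^{1}}\eta(\theta)-E_{\hat G^{2}}\eta(\theta)\big]=0 .$$
   Context: Setup: $\theta_1,\theta_2,\dots$ are i.i.d. from an unknown probability distribution $G$ on the parameter set $\Theta$, with no parametric assumption on $G$. Given the $\theta_i$, the $Y_i$ are independent with $Y_i\sim f(\cdot\mid\theta_i)$, where $\{f(\cdot\mid\theta):\theta\in\Theta\}$ are densities with respect to a dominating measure $\mu$ on the sample space $\Omega$. $P_\theta,E_\theta$ denote probability and expectation when $Y\sim f(\cdot\mid\theta)$. For a probability distribution $G$ on $\Theta$, $E_G\eta(\theta)=\int\eta(\vartheta)\,dG(\vartheta)$. No identifiability of $G$ is assumed, and GMLEs need not be unique. GMLE: for a family of densities $\{g(\cdot\mid\theta)\}$ put $g_G(y)=\int g(y\mid\vartheta)\,dG(\vartheta)$. A GMLE based on a sample is any probability distribution $\hat G$ on $\Theta$ maximizing $\prod_i g_G(Y_i)$, equivalently $\sum_i\log g_G(Y_i)$, over all probability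 distributions $G$ on $\Theta$, the product being over the observations in the sample. The maximal likelihood is positive and finite. Likelihood versions: (1) When $A=\Omega$: $g=f$, with the full sample. (2) Truncated: $g=f^A$, where $f^A(y\mid\theta)=\dfrac{f(y\mid\theta)}{P_\theta(A)}\,I(y\in A)$. Observations outside $A$ are not seen, and the likelihood is over the observations $Y_i\in A$. (3) Censored: $g=f^{AC}$, where $f^{AC}(y\mid\theta)=f^A(y\mid\theta)$ if $y\in A$ and $f^{AC}(y\mid\theta)=P_\theta(A^c)$ if $y\in A^c$. For an observation in $A^c$ only the event $Y_i\in A^c$ is recorded, and the likelihood is over all $n$ observations. Standing assumptions: integrals over $\theta$ and $y$ of $h(y)f(y\mid\theta)$ (or of $h(y)f^A(y\mid\theta)$) exist and the order of integration may be exchanged (Fubini). ''Finite set of possible values'' is understood in the sense that, for all $n$ large enough, every possible value is realized among $Y_1,\dots,Y_n$. *)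

(* Defs.v *)
From HB Require Import structures.
From mathcomp Require Import all_boot all_order all_algebra.
From mathcomp Require Import all_classical all_reals all_analysis measurable_realfun.
Import Order.TTheory GRing.Theory Num.Theory.
Import numFieldNormedType.Exports.

Set Implicit Arguments.
Unset Strict Implicit.
Unset Printing Implicit Defensive.

Local Open Scope classical_set_scope.
Local Open Scope ring_scope.

(* Densities are written [f y t], i.e. f(y | t), for t in the parameter set T
   and y in the sample space O. *)
Definition Pth {R : realType} {dO : measure_display} {O : measurableType dO}
    {T : Type} (mu : {measure set O -> \bar R}) (f : O -> T -> R)
    (t : T) (B : set O) : \bar R :=
  (\int[mu]_(y in B) (f y t)%:E)%E.

(* The last two clauses make the mixture integrals over t meaningful. *)
Definition density_family {R : realType} {dO dT : measure_display}
    {O : measurableType dO} {T : measurableType dT}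
    (mu : {measure set O -> \bar R}) (f : O -> T -> R) : Prop :=
  [/\ (forall y t, 0 <= f y t),
      (forall t, measurable_fun setT (fun y => f y t)),
      (forall t, Pth mu f t setT = 1%E),
      (forall y, measurable_fun setT (f y)) &
      (forall B, measurable B -> measurable_fun setT (fun t => Pth mu f t B))].

(* E_t (h(Y) | Y \in A); the integrals are real-valued. *)
Definition cond_mean {R : realType} {dO : measure_display}
    {O : measurableType dO} {T : Type}
    (mu : {measure set O -> \bar R}) (f : O -> T -> R)
    (h : O -> R) (A : set O) (t : T) : R :=
  (\int[mu]_(y in A) (h y * f y t)) / fine (Pth mu f t A).

Inductive likelihood_version := Full | Truncated | Censored.

Definition trunc_density {R : realType} {dO : measure_display}
    {O : measurableType dO} {T : Type}
    (mu : {measure set O -> \bar R}) (f : O -> T -> R)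
    (A : set O) (y : O) (t : T) : R :=
  f y t / fine (Pth mu f t A) * \1_A y.

Definition lik_density {R : realType} {dO : measure_display}
    {O : measurableType dO} {T : Type}
    (mu : {measure set O -> \bar R}) (f : O -> T -> R)
    (v : likelihood_version) (A : set O) (y : O) (t : T) : R :=
  match v with
  | Full => f y t
  | Truncated => trunc_density mu f A y t
  | Censored => if y \in A then trunc_density mu f A y t
                else fine (Pth mu f t (~` A))
  end.

Definition in_sample {O : Type} (v : likelihood_version) (A : set O) (y : O)
    : bool :=
  if v is Truncated then y \in A else true.

Definition likelihood {R : realType} {dO dT : measure_display}
    {O : measurableType dO} {T : measurableType dT}
    (mu : {measure set O -> \bar R}) (f : O -> T -> R)
    (v : likelihood_version) (A : set O)
    (n : nat) (ys : nat -> O) (G : probability T R) : \bar R :=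
  (\prod_(i < n | in_sample v A (ys i))
     \int[G]_t (lik_density mu f v A (ys i) t)%:E)%E.

Definition is_GMLE {R : realType} {dO dT : measure_display}
    {O : measurableType dO} {T : measurableType dT}
    (mu : {measure set O -> \bar R}) (f : O -> T -> R)
    (v : likelihood_version) (A : set O)
    (n : nat) (ys : nat -> O) (Ghat : probability T R) : Prop :=
  forall G : probability T R,
    (likelihood mu f v A n ys G <= likelihood mu f v A n ys Ghat)%E.

Definition max_likelihood {R : realType} {dO dT : measure_display}
    {O : measurableType dO} {T : measurableType dT}
    (mu : {measure set O -> \bar R}) (f : O -> T -> R)
    (v : likelihood_version) (A : set O) (n : nat) (ys : nat -> O) : \bar R :=
  ereal_sup (range (likelihood (T := T) mu f v A n ys)).

(* The third clause expresses that, given (theta_i)_i, the Y_i are independent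
   with Y_i ~ f(. | theta_i): it is the defining property of the conditional
   probability, tested against the events [theta_i \in B i, i < n], which form
   a pi-system generating the sigma-algebra of the whole sequence theta. *)
Definition mixture_sample {R : realType} {dW dO dT : measure_display}
    {W : measurableType dW} {O : measurableType dO} {T : measurableType dT}
    (P : probability W R) (mu : {measure set O -> \bar R}) (f : O -> T -> R)
    (G : probability T R)
    (theta : nat -> {RV P >-> T}) (Y : nat -> {RV P >-> O}) : Prop :=
  [/\ (forall i (B : set T), measurable B -> P (theta i @^-1` B) = G B),
      (forall n (B : nat -> set T), (forall i, measurable (B i)) ->
         P (\bigcap_(i < n) (theta i @^-1` B i))
         = (\prod_(i < n) P (theta i @^-1` B i))%E) &
      (forall n (B : nat -> set T) (C : nat -> set O),
         (forall i, measurable (B i)) -> (forall i, measurable (C i)) ->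
         P (\bigcap_(i < n) (theta i @^-1` B i `&` Y i @^-1` C i))
         = (\int[P]_(w in \bigcap_(i < n) (theta i @^-1` B i))
              \prod_(i < n) Pth mu f (theta i w) (C i))%E)].

Definition possible_values {R : realType} {dO : measure_display}
    {O : measurableType dO} {T : Type}
    (mu : {measure set O -> \bar R}) (f : O -> T -> R) : set O :=
  [set y | measurable [set y] /\ exists t, (0 < Pth mu f t [set y])%E].

(* The model has finitely many possible values, and almost surely all of them
   are realized in the sample once n is large enough. *)
Definition finitely_many_values {R : realType} {dW dO : measure_display}
    {W : measurableType dW} {O : measurableType dO} {T : Type}
    (P : probability W R) (mu : {measure set O -> \bar R}) (f : O -> T -> R)
    (Y : nat -> {RV P >-> O}) : Prop :=
  [/\ finite_set (possible_values mu f),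
      (forall t, Pth mu f t (~` possible_values mu f) = 0%E) &
      {ae P, forall w, exists N : nat, forall n, (N <= n)%N ->
         forall y, possible_values mu f y -> exists2 i, (i < n)%N & Y i w = y}].

(* For every mixing distribution, the integrals of k over y and over t exist
   and may be exchanged. *)
Definition fubini_for {R : realType} {dO dT : measure_display}
    {O : measurableType dO} {T : measurableType dT}
    (mu : {measure set O -> \bar R}) (k : O -> T -> R) : Prop :=
  forall G : probability T R,
  [/\ (forall t, mu.-integrable setT (fun y => (k y t)%:E)),
      G.-integrable setT (fun t => (\int[mu]_y (k y t)%:E)%E),
      {ae mu, forall y, G.-integrable setT (fun t => (k y t)%:E)},
      mu.-integrable setT (fun y => (\int[G]_t (k y t)%:E)%E) &
      (\int[G]_t \int[mu]_y (k y t)%:E = \int[mu]_y \int[G]_t (k y t)%:E)%E].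

(* Main.v *)
Require Import Defs.
From HB Require Import structures.
From mathcomp Require Import all_boot all_order all_algebra.
From mathcomp Require Import all_classical all_reals all_analysis measurable_realfun.
Import Order.TTheory GRing.Theory Num.Theory.
Import numFieldNormedType.Exports.
From mathcomp Require Import ring.

(** The likelihood depends on the mixing distribution only through the mixture
    densities at the observations in the sample, and it is the product of
    these.  The product is strictly log-concave in these densities, so all
    maximizers share their values: were two GMLEs to disagree at some
    observation, the midpoint of the two, again a probability distribution,
    would have a larger likelihood by the inequality between arithmetic and
    geometric means ([prod_midpoint_eq], [GMLE_mixture_unique]).

    On the other hand, as only finitely many values [y] are possible,
    [E_t (h(Y) | Y \in A)] is a finite sum over the possible [y \in A] of
    [h y * mu {y}] times the truncated density at [y]
    ([cond_mean_finite_sum]).  Integrating over [t], the mean of [eta] under a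
    mixing distribution is a fixed finite linear combination of the mixture
    truncated densities at these [y] ([Rintegral_lincomb]).  In each version
    of the likelihood, the density at [y \in A] is the truncated one.  Almost
    surely, from some sample size on, all possible values have been observed;
    from then on two GMLEs give the same mixture densities at the possible
    [y \in A], hence the same mean of [eta].  The difference of the means is
    thus not only convergent to 0 but eventually equal to 0. *)

Set Implicit Arguments.
Unset Strict Implicit.
Unset Printing Implicit Defensive.

Local Open Scope classical_set_scope.
Local Open Scope ring_scope.

(** * Uniqueness of the maximizing mixture densities *)

(** Strict log-concavity of the product on positive families: each factor
    satisfies [((a + b) / 2)^2 = a b + ((a - b) / 2)^2], so a single index with
    [a i != b i] makes the squared product of the midpoints exceed
    [\prod a * \prod b]. *)
Lemma prod_midpoint_eq (R : realFieldType) (I : finType) (Q : pred I)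
    (a b : I -> R) :
  (forall i, Q i -> 0 < a i) -> (forall i, Q i -> 0 < b i) ->
  \prod_(i | Q i) a i = \prod_(i | Q i) b i ->
  \prod_(i | Q i) ((a i + b i) / 2) <= \prod_(i | Q i) a i ->
  forall i, Q i -> a i = b i.
Proof.
move=> a0 b0 ab le_mid j Qj; apply/eqP/negPn/negP => neq_ab.
have a_gt0 : 0 < \prod_(i | Q i) a i by apply: prodr_gt0.
have : \prod_(i | Q i) (a i * b i) < \prod_(i | Q i) ((a i + b i) / 2) ^+ 2.
  have amgm i : ((a i + b i) / 2) ^+ 2 = a i * b i + ((a i - b i) / 2) ^+ 2.
    by field.
  rewrite (bigD1 j)//= [ltRHS](bigD1 j)//=.
  apply: (@lt_le_trans _ _
      (((a j + b j) / 2) ^+ 2 * \prod_(i | Q i && (i != j)) (a i * b i))).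
    rewrite ltr_pM2r; last first.
      by apply: prodr_gt0 => i /andP[Qi _]; rewrite mulr_gt0 ?a0 ?b0.
    rewrite amgm ltrDl exprn_even_gt0//= mulf_neq0 ?subr_eq0//.
  rewrite ler_wpM2l ?sqr_ge0//; apply: ler_prod => i /andP[Qi _].
  by rewrite amgm lerDl sqr_ge0 andbT ltW// mulr_gt0 ?a0 ?b0.
rewrite big_split/= -ab -expr2 prodrXl ltNge; apply/negP/negPn.
rewrite lerXn2r// ?nnegrE ?ltW//.
by apply: prodr_gt0 => i Qi; rewrite divr_gt0 ?addr_gt0 ?a0 ?b0.
Qed.

(** Since [0 * +oo = 0] and a positive factor times [+oo] is [+oo], a product of
    nonnegative extended reals that is positive and finite has no factor [0] or
    [+oo].  This brings the comparison of likelihoods down to real numbers. *)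
Lemma prode_gt0_lty_factor (R : realType) (I : finType) (Q : pred I)
    (F : I -> \bar R) :
  (forall i, Q i -> (0 <= F i)%E) -> (0 < \prod_(i | Q i) F i < +oo)%E ->
  forall i, Q i -> (0 < F i < +oo)%E.
Proof.
move=> F0 + j Qj; rewrite (bigD1 j)//=.
set r := (\prod_(_ | _) _)%E.
have r0 : (0 <= r)%E by apply: prode_ge0 => i /andP[Qi _]; exact: F0.
move=> /andP[Fr0 Froo]; apply/andP; split.
  rewrite lt_neqAle F0// andbT; apply/eqP => Fj0.
  by move: Fr0; rewrite -Fj0 mul0e ltxx.
rewrite ltey; apply/eqP => Fjoo; move: Fr0 Froo; rewrite Fjoo.
move: r0; rewrite le_eqVlt => /predU1P[<-|r0]; first by rewrite mule0 ltxx.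
by rewrite gt0_mulye// ltxx.
Qed.

Lemma midpoint_mixture (R : realType) (d : measure_display)
    (T : measurableType d) (G1 G2 : probability T R) :
  exists G : probability T R, forall g : T -> R,
    measurable_fun setT g -> (forall t, 0 <= g t) ->
    (\int[G]_t (g t)%:E =
     (2^-1)%:E * (\int[G1]_t (g t)%:E + \int[G2]_t (g t)%:E))%E.
Proof.
have half0 : 0 <= 2^-1 :> R by [].
pose m : {measure set T -> \bar R} :=
  mscale (NngNum half0) (measure_add G1 G2).
have m1 : m setT = 1%E.
  transitivity ((2^-1)%:E * (1 + 1) : \bar R)%E.
    rewrite -[LHS]/((2^-1)%:E * measure_add G1 G2 setT)%E measure_addE.
    by congr (_ * (_ + _))%E; exact: probability_setT.
  by rewrite -EFinD -EFinM; congr (_%:E); field.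
pose H := Measure_isProbability.Build _ _ _ m m1.
exists (HB.pack_for (probability T R)
  (mscale (NngNum half0) (measure_add G1 G2)) H) => g mg g0.
have mEg : measurable_fun setT (EFin \o g) by exact/measurable_EFinP.
have g0' t : setT t -> (0 <= (EFin \o g) t)%E by rewrite lee_fin.
rewrite -(ge0_integral_measure_add G1 G2 measurableT g0' mEg).
exact: (ge0_integral_mscale (measure_add G1 G2) measurableT _ mEg g0').
Qed.

(** Inversion is not continuous at 0; on nonnegative reals it is a power, and
   powers are measurable. *)
Lemma measurable_inv_fun (R : realType) (d : measure_display)
    (T : measurableType d) (g : T -> R) :
  (forall t, 0 <= g t) -> measurable_fun setT g ->
  measurable_fun setT (fun t => (g t)^-1).
Proof.
move=> g0 mg; rewrite (_ : (fun t => _) = (fun t => g t `^ (-1))).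
  exact: measurableT_comp (measurable_powR _) mg.
by apply/funext => t; rewrite powR_inv1.
Qed.


Lemma Pth_bounds (R : realType) (dO dT : measure_display)
    (O : measurableType dO) (T : measurableType dT)
    (mu : {measure set O -> \bar R}) (f : O -> T -> R)
    (hf : density_family mu f) (t : T) (B : set O) :
  measurable B -> (0 <= Pth mu f t B <= 1)%E.
Proof.
case: hf => f0 mf f1 _ _ mB; apply/andP; split.
  by apply: integral_ge0 => y _; rewrite lee_fin.
rewrite -(f1 t); apply: ge0_subset_integral => //.
- exact/measurable_EFinP.
- by move=> y _; rewrite lee_fin.
Qed.

Lemma lik_density_ge0 (R : realType) (dO dT : measure_display)
    (O : measurableType dO) (T : measurableType dT)
    (mu : {measure set O -> \bar R}) (f : O -> T -> R)
    (hf : density_family mu f) (v : likelihood_version) (A : set O)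
    (mA : measurable A) (y : O) (t : T) :
  0 <= lik_density mu f v A y t.
Proof.
have Pge0 B : measurable B -> 0 <= fine (Pth mu f t B).
  by move=> mB; apply: fine_ge0; case/andP: (Pth_bounds hf t mB).
have f0 : 0 <= f y t by case: hf.
have tr0 : 0 <= trunc_density mu f A y t.
  by rewrite !mulr_ge0 ?invr_ge0 ?Pge0.
case: v => //=; case: ifP => // _.
by apply: Pge0; exact: measurableC.
Qed.

Lemma measurable_lik_density (R : realType) (dO dT : measure_display)
    (O : measurableType dO) (T : measurableType dT)
    (mu : {measure set O -> \bar R}) (f : O -> T -> R)
    (hf : density_family mu f) (v : likelihood_version) (A : set O)
    (mA : measurable A) (y : O) :
  measurable_fun setT (lik_density mu f v A y).
Proof.
have mP B : measurable B -> measurable_fun setT (fun t => fine (Pth mu f t B)).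
  move=> mB; case: hf => _ _ _ _ /(_ B mB) mPB.
  exact: (measurableT_comp (fine_measurable measurableT) mPB).
have mfy : measurable_fun setT (f y) by case: hf.
have mtr : measurable_fun setT (trunc_density mu f A y).
  apply: measurable_funM => //; apply: measurable_funM => //.
  apply: measurable_inv_fun; last exact: mP.
  by move=> t; apply: fine_ge0; case/andP: (Pth_bounds hf t mA).
rewrite /lik_density; case: v; [exact: mfy|exact: mtr|].
by case: (y \in A); [exact: mtr|apply: mP; exact: measurableC].
Qed.

(** A GMLE attains the maximal likelihood, whose positivity and finiteness make
    all the mixture densities at the sample positive reals; the midpoint
    mixture, which is one of the competitors, then forces equality. *)
Lemma GMLE_mixture_unique (R : realType) (dO dT : measure_display)
    (O : measurableType dO) (T : measurableType dT)
    (mu : {measure set O -> \bar R}) (f : O -> T -> R)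
    (hf : density_family mu f) (v : likelihood_version) (A : set O)
    (mA : measurable A) (n : nat) (ys : nat -> O) (G1 G2 : probability T R) :
  (0 < max_likelihood (T := T) mu f v A n ys < +oo)%E ->
  is_GMLE mu f v A n ys G1 -> is_GMLE mu f v A n ys G2 ->
  forall i, (i < n)%N -> in_sample v A (ys i) ->
  (\int[G1]_t (lik_density mu f v A (ys i) t)%:E =
   \int[G2]_t (lik_density mu f v A (ys i) t)%:E)%E.
Proof.
move=> /andP[max_gt0 max_ltoo] gmle1 gmle2.
pose Q (i : 'I_n) := in_sample v A (ys i).
pose F (G : probability T R) (i : 'I_n) :=
  (\int[G]_t (lik_density mu f v A (ys i) t)%:E)%E.
have F_ge0 G i : (0 <= F G i)%E.
  by apply: integral_ge0 => t _; rewrite lee_fin lik_density_ge0.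
have F_fin G : is_GMLE mu f v A n ys G -> forall i, Q i -> (0 < F G i < +oo)%E.
  move=> gmle; apply: prode_gt0_lty_factor => [i _|]; first exact: F_ge0.
  apply/andP; split.
    apply: (lt_le_trans max_gt0); apply: ge_ereal_sup => _ [G' _ <-].
    exact: gmle.
  by apply: le_lt_trans max_ltoo; apply: ereal_sup_ubound; exists G.
have FE G : is_GMLE mu f v A n ys G -> forall i, Q i -> F G i = (fine (F G i))%:E.
  move=> gmle i Qi; rewrite fineK// ge0_fin_numE//.
  by case/andP: (F_fin G gmle i Qi).
have FP G : is_GMLE mu f v A n ys G -> forall i, Q i -> 0 < fine (F G i).
  by move=> gmle i Qi; exact: fine_gt0 (F_fin G gmle i Qi).
have LE G : is_GMLE mu f v A n ys G ->
    likelihood mu f v A n ys G = (\prod_(i | Q i) fine (F G i))%:E.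
  by move=> gmle; rewrite -prodEFin; apply: eq_bigr => i Qi; exact: FE.
have [H HE] := midpoint_mixture G1 G2.
have LH : likelihood mu f v A n ys H =
    (\prod_(i | Q i) ((fine (F G1 i) + fine (F G2 i)) / 2))%:E.
  rewrite -prodEFin; apply: eq_bigr => i Qi.
  rewrite HE; first last.
  - by move=> t; exact: lik_density_ge0.
  - exact: measurable_lik_density.
  by rewrite -/(F G1 i) -/(F G2 i) (FE G1)// (FE G2)// mulrC.
move=> i0 lt_i0n Qi0; pose i : 'I_n := Ordinal lt_i0n.
rewrite -/(F G1 i) -/(F G2 i) (FE G1)// (FE G2)//; congr (_%:E).
apply: (@prod_midpoint_eq R _ Q (fun i => fine (F G1 i))
  (fun i => fine (F G2 i))) => //; [exact: FP|exact: FP| |].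
  apply: EFin_inj; rewrite -!LE//.
  by apply/eqP; rewrite eq_le gmle2 gmle1.
by rewrite -lee_fin -LH -LE//; exact: gmle1.
Qed.

(** * Means as finite combinations of mixture densities *)

Lemma Pth_set1 (R : realType) (dO dT : measure_display)
    (O : measurableType dO) (T : measurableType dT)
    (mu : {measure set O -> \bar R}) (f : O -> T -> R) (t : T) (y : O) :
  measurable [set y] -> Pth mu f t [set y] = ((f y t)%:E * mu [set y])%E.
Proof.
move=> my; rewrite -integral_cst//; apply: eq_integral => z.
by rewrite inE => ->.
Qed.

(** [P_t {y}] is [f y t * mu {y}] and lies in [0, 1]; for a [t] that makes it
    positive, both factors are positive and neither can be infinite. *)
Lemma possible_value_mass (R : realType) (dO dT : measure_display)
    (O : measurableType dO) (T : measurableType dT)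
    (mu : {measure set O -> \bar R}) (f : O -> T -> R)
    (hf : density_family mu f) (y : O) :
  possible_values mu f y -> (0 < mu [set y] < +oo)%E.
Proof.
move=> [my [t]]; rewrite Pth_set1// => P_gt0.
have fy0 : (0 <= (f y t)%:E)%E by rewrite lee_fin; case: hf.
have fy_gt0 : (0 < (f y t)%:E)%E.
  rewrite lt_neqAle fy0 andbT; apply/eqP => fyE.
  by move: P_gt0; rewrite -fyE mul0e ltxx.
apply/andP; split.
  rewrite lt_neqAle measure_ge0 andbT; apply/eqP => muE.
  by move: P_gt0; rewrite -muE mule0 ltxx.
rewrite ltey; apply/eqP => muE.
have /andP[_] := Pth_bounds hf t my.
by rewrite Pth_set1// muE gt0_muley.
Qed.

(** The infimum is finite because [T] has a point and probabilities are at
    most 1. *)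
Lemma Pth_uniform_lower_bound (R : realType) (dO dT : measure_display)
    (O : measurableType dO) (T : measurableType dT)
    (mu : {measure set O -> \bar R}) (f : O -> T -> R)
    (hf : density_family mu f) (A : set O) (mA : measurable A) :
  (0 < ereal_inf (range (fun t => Pth mu f t A)))%E ->
  exists2 c : R, 0 < c & forall t, c <= fine (Pth mu f t A).
Proof.
set i := ereal_inf _ => i_gt0.
have i_le t : (i <= Pth mu f t A)%E by apply: ereal_inf_lbound; exists t.
have P_fin t : Pth mu f t A \is a fin_num.
  have /andP[P0 P1] := Pth_bounds hf t mA.
  by rewrite ge0_fin_numE// (le_lt_trans P1)// ltry.
have i_fin : i \is a fin_num.
  rewrite ge0_fin_numE ?(ltW i_gt0)//.
  by rewrite (le_lt_trans (i_le point))// ltey_eq P_fin.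
exists (fine i); first by rewrite fine_gt0// i_gt0 ltey_eq i_fin.
by move=> t; rewrite fine_le.
Qed.

(** At a possible value [y] the truncated density is bounded in [t]: its
    numerator by [1 / mu {y}], as [f y t * mu {y} = P_t {y} <= 1], and its
    denominator from below by the positive infimum of [P_t A]. *)
Lemma integrable_trunc_density (R : realType) (dO dT : measure_display)
    (O : measurableType dO) (T : measurableType dT)
    (mu : {measure set O -> \bar R}) (f : O -> T -> R)
    (hf : density_family mu f) (A : set O) (mA : measurable A)
    (hA : (0 < ereal_inf (range (fun t => Pth mu f t A)))%E)
    (y : O) (G : probability T R) :
  possible_values mu f y ->
  G.-integrable setT (EFin \o trunc_density mu f A y).
Proof.
move=> ypos; have [c c0 c_le] := Pth_uniform_lower_bound hf mA hA.
have /andP[m0 moo] := possible_value_mass hf ypos.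
have [my _] := ypos.
have mE : mu [set y] = (fine (mu [set y]))%:E by rewrite fineK// ge0_fin_numE.
have m_gt0 : 0 < fine (mu [set y]) by rewrite fine_gt0// m0.
have tr_ge0 t : 0 <= trunc_density mu f A y t.
  exact: (lik_density_ge0 hf Truncated mA y t).
have tr_le t : trunc_density mu f A y t <= (fine (mu [set y]))^-1 / c.
  have f0 : 0 <= f y t by case: hf.
  have p0 : 0 < fine (Pth mu f t A) by rewrite (lt_le_trans c0).
  rewrite /trunc_density (@le_trans _ _ (f y t / fine (Pth mu f t A)))//.
    apply: ler_piMr; first by rewrite divr_ge0// ltW.
    by rewrite indicE lern1 leq_b1.
  apply: ler_pM => //; first by rewrite invr_ge0 ltW.
    rewrite -[leRHS]mul1r ler_pdivlMr//.
    have /andP[_] := Pth_bounds hf t my.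
    by rewrite Pth_set1// mE -EFinM lee_fin.
  by rewrite lef_pV2.
apply: (@le_integrable _ _ _ _ _ measurableT _
    (cst ((fine (mu [set y]))^-1 / c)%:E)).
- apply/measurable_EFinP.
  exact: (measurable_lik_density hf Truncated mA y).
- move=> t _ /=; rewrite !ger0_norm ?lee_fin//.
  exact: le_trans (tr_ge0 t) (tr_le t).
- by apply: finite_measure_integrable_cst.
Qed.

Lemma measurable_finite_of_set1 (d : measure_display) (O : measurableType d)
    (S : set O) :
  finite_set S -> (forall y, S y -> measurable [set y]) -> measurable S.
Proof.
move=> Sfin mS1; rewrite (_ : S = \bigcup_(y in S) [set y]).
  exact: fin_bigcup_measurable.
by apply/seteqP; split=> [y Sy|y [z Sz ->]]//; exists y.
Qed.

Lemma Rintegral_seq (R : realType) (d : measure_display)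
    (O : measurableType d) (mu : {measure set O -> \bar R}) (k : O -> R)
    (s : seq O) :
  uniq s -> (forall y, y \in s -> measurable [set y]) ->
  mu.-integrable [set` s] (EFin \o k) ->
  \int[mu]_(y in [set` s]) k y = \sum_(y <- s) k y * fine (mu [set y]).
Proof.
elim: s => [_ _ _|x s IHs /andP[xs us] ms].
  by rewrite set_nil Rintegral_set0 big_nil.
have mx : measurable [set x] by apply: ms; exact: mem_head.
have {}ms y : y \in s -> measurable [set y].
  by move=> ys; apply: ms; rewrite in_cons ys orbT.
have mS : measurable [set` s].
  by apply: measurable_finite_of_set1 => //; exact: finite_seq.
have -> : [set` x :: s] = [set x] `|` [set` s].
  apply/seteqP; split=> y /=; rewrite in_cons; first by move=> /predU1P.
  by move=> [->|->]; rewrite ?eqxx ?orbT.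
rewrite big_cons => k_int.
rewrite Rintegral_setU//; last first.
  by apply/disj_setPS => y [-> ys]; rewrite /= ys in xs.
rewrite IHs//; last first.
  by apply: integrableS k_int => //; exact: measurableU.
congr (_ + _).
rewrite (@eq_Rintegral _ _ _ mu _ (cst (k x))); last first.
  by move=> y; rewrite inE => ->.
by rewrite Rintegral_cst.
Qed.

(** Outside [S] the density [f y t] vanishes for almost every [y], so that only
    the points of [A] in [S] contribute.  The function [h] itself may fail to
    be measurable; the integrability of the product provides the measurability
    that discarding a negligible part requires. *)
Lemma cond_mean_finite_sum (R : realType) (dO dT : measure_display)
    (O : measurableType dO) (T : measurableType dT)
    (mu : {measure set O -> \bar R}) (f : O -> T -> R)
    (hf : density_family mu f) (h : O -> R) (A S : set O) (s : seq O) (t : T) :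
  measurable A -> (forall y, S y -> measurable [set y]) ->
  Pth mu f t (~` S) = 0%E -> measurable S ->
  0 < fine (Pth mu f t A) ->
  uniq s -> A `&` S = [set` s] ->
  mu.-integrable setT (fun y => (h y * trunc_density mu f A y t)%:E) ->
  cond_mean mu f h A t =
  \sum_(y <- s) h y * fine (mu [set y]) * trunc_density mu f A y t.
Proof.
move=> mA mS1 PS0 mS p_gt0 us sE k_int.
set k := fun y => h y * trunc_density mu f A y t in k_int *.
have k_intA B : measurable B -> mu.-integrable B (EFin \o k).
  by move=> mB; exact: (integrableS measurableT mB (@subsetT _ _) k_int).
have hfE : {in A, (fun y => h y * f y t) =1
                  (fun y => fine (Pth mu f t A) * k y)}.
  move=> y; rewrite inE => Ay.
  rewrite /k /trunc_density indicE mem_set// mulr1.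
  by field; rewrite gt_eqF.
have mAS : measurable (A `&` S) by exact: measurableI.
have mAnS : measurable (A `&` ~` S).
  by apply: measurableI => //; exact: measurableC.
(* The normalizing constant cancels, leaving the integral of [k] over [A]. *)
rewrite /cond_mean (eq_Rintegral mu hfE) RintegralZl//; last exact: k_intA.
rewrite mulrAC divff ?gt_eqF// mul1r.
have {1}-> : A = (A `&` S) `|` (A `&` ~` S) by rewrite -setIUr setUv setIT.
rewrite Rintegral_setU//; first last.
- by apply/disj_setPS => y [[_ Sy] [_ /(_ Sy)]].
- by apply: k_intA; exact: measurableU.
(* [f] vanishes almost everywhere on the complement of [S], hence so does [k]
   there. *)
have -> : \int[mu]_(y in A `&` ~` S) k y = 0.
  rewrite /Rintegral (_ : integral _ _ _ = 0%E)//.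
  have mf : measurable_fun setT (EFin \o (f ^~ t)).
    by apply/measurable_EFinP; case: hf.
  have f_ae0 : ae_eq mu (~` S) (EFin \o (f ^~ t)) (cst 0%E).
    apply/ae_eq_integral_abs; first exact: measurableC.
      exact: measurable_funTS.
    rewrite -PS0; apply: eq_integral => y _ /=.
    by rewrite ger0_norm//; case: hf.
  rewrite (ae_eq_integral (cst 0%E))//; first exact: integral0.
    by have /integrableP[] := k_intA _ mAnS.
  apply: filterS f_ae0 => y /= fy0 [Ay nSy].
  have fyt0 : f y t = 0 by apply: EFin_inj; exact: fy0 nSy.
  by rewrite /k /trunc_density fyt0 !mul0r mulr0.
have memS y : y \in s -> S y.
  by move=> ys; have : (A `&` S) y by [rewrite sE]; case.
rewrite addr0 sE (Rintegral_seq us)//.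
- by apply: eq_bigr => y _; rewrite mulrAC.
- by move=> y ys; exact: mS1 (memS y ys).
- by rewrite -sE; exact: k_intA.
Qed.

Lemma Rintegral_lincomb (R : realType) (d : measure_display)
    (T : measurableType d) (G : {measure set T -> \bar R}) (I : eqType)
    (s : seq I) (c : I -> R) (g : I -> T -> R) :
  (forall i, i \in s -> G.-integrable setT (EFin \o g i)) ->
  \int[G]_t (\sum_(i <- s) c i * g i t) =
  \sum_(i <- s) c i * \int[G]_t g i t.
Proof.
elim: s => [|i s IHs] g_int.
  under eq_Rintegral do rewrite big_nil.
  by rewrite Rintegral_cst// mul0r big_nil.
have cg_int j : j \in i :: s -> G.-integrable setT (fun t => (c j * g j t)%:E).
  by move=> /g_int gj; exact: (integrableZl measurableT (c j) gj).
under eq_Rintegral do rewrite big_cons.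
have is_ j : j \in s -> j \in i :: s by rewrite in_cons orbC => ->.
rewrite big_cons RintegralD//; last 2 first.
- exact/cg_int/mem_head.
- rewrite (_ : _ \o _ = fun t => \sum_(j <- s | j \in s) (c j * g j t)%:E)%E.
    by apply: integrable_sum => // j /is_; exact: cg_int.
  by apply/funext => t /=; rewrite -sumEFin big_seq.
rewrite RintegralZl//; last exact/g_int/mem_head.
by rewrite IHs// => j /is_; exact: g_int.
Qed.

(** * Asymptotic agreement of the means *)

Theorem theorem1 (R : realType) (dW dO dT : measure_display)
    (W : measurableType dW) (O : measurableType dO) (T : measurableType dT)
    (P : probability W R)
    (mu : {measure set O -> \bar R}) (f : O -> T -> R)
    (hf : density_family mu f)
    (G : probability T R)
    (theta : nat -> {RV P >-> T}) (Y : nat -> {RV P >-> O})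
    (hmodel : mixture_sample mu f G theta Y)
    (hfin : finitely_many_values mu f Y)
    (eta : T -> R) (h : O -> R) (A : set O) (mA : measurable A)
    (hfubini : fubini_for mu (fun y t => h y * trunc_density mu f A y t))
    (hi : forall t, eta t = cond_mean mu f h A t)
    (hii : (0 < ereal_inf (range (fun t => Pth mu f t A)))%E)
    (v : likelihood_version) (hv : v = Full -> A = setT)
    (hmax : forall n, {ae P, forall w,
       (0 < max_likelihood (T := T) mu f v A n (Y ^~ w) < +oo)%E})
    (G1 G2 : nat -> W -> probability T R)
    (hG1 : forall n,
       {ae P, forall w, is_GMLE mu f v A n (Y ^~ w) (G1 n w)})
    (hG2 : forall n,
       {ae P, forall w, is_GMLE mu f v A n (Y ^~ w) (G2 n w)}) :
  {ae P, forall w,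
    (fun n => \int[G1 n w]_t eta t - \int[G2 n w]_t eta t) @ \oo --> (0 : R)}.
Proof.
have [Sfin PS0 Sseen] := hfin.
set S := possible_values mu f in Sfin PS0 Sseen.
have mS1 y : S y -> measurable [set y] by case.
have mS : measurable S by exact: measurable_finite_of_set1.
have [s us sE] : exists2 s, uniq s & A `&` S = [set` s].
  have /finite_seqP[s sE] : finite_set (A `&` S) by exact: finite_setIr.
  exists (undup s); first exact: undup_uniq.
  by rewrite sE; apply/seteqP; split=> y /=; rewrite mem_undup.
have sAS y : y \in s -> A y /\ S y.
  by move=> ys; have : (A `&` S) y by rewrite sE.
have [k_int _ _ _ _] := hfubini G.
have [c c0 c_le] := Pth_uniform_lower_bound hf mA hii.
have etaE t : eta t =
    \sum_(y <- s) h y * fine (mu [set y]) * trunc_density mu f A y t.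
  rewrite hi; apply: (cond_mean_finite_sum hf mA mS1 (PS0 t) mS _ us sE) => //.
  exact: lt_le_trans (c_le t).
have meanE (H : probability T R) : \int[H]_t eta t =
    \sum_(y <- s) h y * fine (mu [set y]) * \int[H]_t trunc_density mu f A y t.
  rewrite -Rintegral_lincomb; last first.
    by move=> y /sAS[_ Sy]; exact: integrable_trunc_density.
  by apply: eq_Rintegral => ? _; exact: etaE.
have truncE y : A y -> lik_density mu f v A y = trunc_density mu f A y.
  move=> Ay; apply/funext => t; rewrite /lik_density.
  case: v hv {hmax hG1 hG2} => [/(_ erefl) AT| |]//; last by rewrite mem_set.
  have [_ _ f1 _ _] := hf.
  by rewrite /trunc_density AT f1 divr1 indicT mulr1.
have sampleE y : A y -> in_sample v A y.
  by move=> Ay; rewrite /in_sample; case: (v) => //; rewrite mem_set.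
have hGMLE : {ae P, forall w, forall n,
    [/\ (0 < max_likelihood (T := T) mu f v A n (Y ^~ w) < +oo)%E,
        is_GMLE mu f v A n (Y ^~ w) (G1 n w) &
        is_GMLE mu f v A n (Y ^~ w) (G2 n w)]}.
  apply: ae_foralln => n; move: (hmax n) (hG1 n) (hG2 n).
  by apply: filterS3 => w.
move: hGMLE Sseen; apply: filterS2 => w gmle [N seen].
(* Once all possible values have been seen, the difference is exactly 0. *)
apply: cvg_near_cst; near=> n.
have Nn : (N <= n)%N by near: n; exact: nbhs_infty_ge.
rewrite !meanE -sumrB big_seq big1// => y /sAS[Ay Sy].
have [i lt_in Yi] := seen n Nn y Sy.
have [max_n gmle1 gmle2] := gmle n.
have := GMLE_mixture_unique hf mA max_n gmle1 gmle2 lt_in.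
rewrite Yi truncE// => /(_ (sampleE y Ay)) mixE.
by rewrite -mulrBr /Rintegral mixE subrr mulr0.
Unshelve. all: by end_near.
Qed.
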